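(* Let $G$ be a graph without isolated vertices and let $\varepsilon$ be a clique covering of $G$. Let $x$ be the vector with $x_u=d_u^\varepsilon$ for $u\in V(G)$. Then $$\alpha(G)\le F(A_\varepsilon,x)=x^\top A_\varepsilon^\#x\max_{u\in V(G)}\frac{(A_\varepsilon)_{uu}}{x_u^2},$$ with equality if and only if there is an independent set $C$ such that $d_v^\varepsilon=\min_{u\in V(G)}d_u^\varepsilon$ for every $v\in C$ and $|C\cap Q|=1$ for every $Q\in\varepsilon$. Moreover, if an independent set $C$ satisfies these conditions, then $$\alpha(G)=\Theta(G)=\vartheta(G)=|C|=F(A_\varepsilon,x).$$
   Context: A clique covering of $G$ is a set $\varepsilon=\{Q_1,\dots,Q_r\}$ of cliques of $G$ such that every edge lies in at least one $Q_i$. The $\varepsilon$-degree $d_u^\varepsilon$ of a vertex $u$ is the number of cliques in $\varepsilon$ containing $u$. The clique covering matrix $A_\varepsilon$ is the symmetric matrix indexed by $V(G)$ with $(A_\varepsilon)_{ii}=d_i^\varepsilon$, $(A_\varepsilon)_{ij}=w_{ij}$ (the number of cliques in $\varepsilon$ containing edge $\{i,j\}$) if $\{i,j\}\in E(G)$, and $0$ otherwise. $A_\varepsilon^\#$ is the group inverse (unique $X$ with $A_\varepsilon XA_\varepsilon=A_\varepsilon$, $XA_\varepsilon X=X$, $A_\varepsilon X=XA_\varepsilon$). $\alpha(G)$ is the independence number; $\Theta(G)=\lim_k\alpha(G^k)^{1/k}$ is the Shannon capacity, with $G^k$ the strong power (vertex set $V^k$, distinct tuples adjacent iff in each coordinate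 they are equal or adjacent); $\vartheta(G)$ is the Lovász theta function (minimum largest eigenvalue of a real symmetric matrix indexed by $V(G)$ with entry $1$ whenever $i=j$ or $i,j$ nonadjacent). *)

(* Defs.v *)
From HB Require Import structures.
From mathcomp Require Import all_boot all_order all_algebra.
From mathcomp Require Import all_classical all_reals all_analysis.

Set Implicit Arguments.
Unset Strict Implicit.
Unset Printing Implicit Defensive.

Import Order.TTheory GRing.Theory Num.Theory.
Import numFieldNormedType.Exports.

Local Open Scope classical_set_scope.
Local Open Scope ring_scope.

(** A finite simple graph is a symmetric irreflexive adjacency relation
    [e : rel T] on a finite vertex type [T]. Matrices and vectors indexed by
    [T] have dimension [#|T|]; index [i] stands for the vertex [enum_val i]. *)

Section Graphs.
Variables (T : finType) (e : rel T).

Definition no_isolated_vertices : Prop := forall u : T, exists v : T, e u v.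

Definition independent (S : {set T}) : bool :=
  [forall u in S, forall v in S, ~~ e u v].

Definition independence_number : nat :=
  \max_(S : {set T} | independent S) #|S|.

(** Cliques are nonempty; single vertices are allowed. An empty member of a
    covering would be invisible to the clique covering matrix but could not
    meet an independent set. *)
Definition clique (Q : {set T}) : bool :=
  (Q != finset.set0) && [forall u in Q, forall v in Q, (u != v) ==> e u v].

Definition clique_covering (E : {set {set T}}) : Prop :=
  (forall Q, Q \in E -> clique Q) /\
  (forall u v, e u v -> exists2 Q, Q \in E & (u \in Q) && (v \in Q)).

Definition strong_power (k : nat) : rel (k.-tuple T) :=
  fun a b => (a != b) &&
    [forall i : 'I_k, (tnth a i == tnth b i) || e (tnth a i) (tnth b i)].

End Graphs.

Section CliqueCovering.
Variables (T : finType) (E : {set {set T}}).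

Definition cov_degree (u : T) : nat := #|[set Q in E | u \in Q]|.

Definition cov_weight (u v : T) : nat :=
  #|[set Q in E | (u \in Q) && (v \in Q)]|.

(** Every degree is at most [#|E|], so this default value does not change the
    minimum when [T] is nonempty. *)
Definition min_cov_degree : nat := \big[minn/#|E|]_(u : T) cov_degree u.

Variables (R : realType) (e : rel T).

Definition clique_covering_matrix : 'M[R]_#|T| :=
  \matrix_(i, j)
    let u := enum_val i in let v := enum_val j in
    if u == v then (cov_degree u)%:R
    else if e u v then (cov_weight u v)%:R else 0.

Definition cov_degree_vector : 'cV[R]_#|T| :=
  \col_i (cov_degree (enum_val i))%:R.

Definition tight_independent_set (C : {set T}) : Prop :=
  [/\ independent e C,
      forall v, v \in C -> cov_degree v = min_cov_degree
    & forall Q, Q \in E -> #|C :&: Q| = 1%N].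

End CliqueCovering.

Section Reals.
Variable R : realType.

(** The greatest and least elements of a set of reals (0 if there is none). *)
Definition set_max (S : set R) : R := xget 0 [set m | S m /\ ubound S m].
Definition set_min (S : set R) : R := xget 0 [set m | S m /\ lbound S m].

Definition is_group_inverse n (A X : 'M[R]_n) : Prop :=
  [/\ A *m X *m A = A, X *m A *m X = X & A *m X = X *m A].

(** Such an [X] is unique if it exists, and exists for symmetric [A]. *)
Definition group_inverse n (A : 'M[R]_n) : 'M[R]_n :=
  xget 0 [set X | is_group_inverse A X].

Definition F_bound n (A : 'M[R]_n) (x : 'cV[R]_n) : R :=
  (x^T *m group_inverse A *m x) ord0 ord0 *
  set_max (range (fun u : 'I_n => A u u / x u ord0 ^+ 2)).

Definition largest_eigenvalue n (M : 'M[R]_n) : R :=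
  set_max [set a | eigenvalue M a].

Variables (T : finType) (e : rel T).

Definition theta_feasible (M : 'M[R]_#|T|) : Prop :=
  M^T = M /\
  forall i j, (i == j) || ~~ e (enum_val i) (enum_val j) -> M i j = 1.

Definition lovasz_theta : R :=
  set_min [set largest_eigenvalue M | M in theta_feasible].

Definition shannon_capacity : R :=
  lim ((fun k : nat =>
    ((independence_number (strong_power e (k := k)))%:R : R) `^ (k%:R^-1))
      @ \oo).

End Reals.

(* Main.v *)
Require Import Defs.
From HB Require Import structures.
From mathcomp Require Import all_boot all_order all_algebra.
From mathcomp Require Import all_classical all_reals all_analysis.
From mathcomp Require Import ring.

Set Implicit Arguments.
Unset Strict Implicit.
Unset Printing Implicit Defensive.

Import Order.TTheory GRing.Theory Num.Theory.
Import numFieldNormedType.Exports.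

Local Open Scope ring_scope.

(* Let [N] be the vertex-clique incidence matrix, so that [A = N N^T] and
   [x = N 1]. Writing [x = A z] and [p = N^T z], the group inverse disappears:
   [x^T A^# x = |p|^2], hence [F = |p|^2 / delta] with [delta] the least degree.
   For an independent set [C] let [q = N^T y] with [y_u = 1 / d_u] on [C]; as a
   clique meets [C] at most once, [p.q = |C|] and [|q|^2 = sum_C 1 / d_u], whence
     |p|^2 - delta |C| = |p - delta q|^2 + delta sum_C (1 - delta / d_u).
   Both terms on the right are nonnegative, and they vanish exactly when [C] is
   tight.

   If [C] is tight then [|E| = delta |C|]. Counting pairs of a vertex of an
   independent set [S] of [G^k] and a product of [k] cliques containing it gives
   [|S| delta^k <= |E|^k], so [alpha (G^k) = |C|^k]. For theta, every feasible
   matrix has largest eigenvalue at least [|C|] by the Rayleigh quotient at the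
   indicator of [C], and the matrix with off-diagonal entries
   [1 - |E| w_uv / (d_u d_v)] attains [|C|]. *)

(** * Gram matrices and group inverses *)

(** The diagonal of [B^T *m B] holds the squared norms of the columns of [B]. *)
Lemma mulmx_tr_eq0 (R : realFieldType) m n (B : 'M[R]_(m, n)) :
  B^T *m B = 0 -> B = 0.
Proof.
move=> BB0; apply/matrixP => i j; rewrite mxE.
have /matrixP/(_ j j) := BB0; rewrite !mxE => s0.
have: \sum_k B k j ^+ 2 = 0.
  by rewrite -[RHS]s0; apply: eq_bigr => k _; rewrite mxE expr2.
move/(psumr_eq0P (fun k _ => sqr_ge0 (B k j)))/(_ i isT)/eqP.
by rewrite sqrf_eq0 => /eqP.
Qed.

(** If [K] is the cokernel of [N *m N^T], then [N^T *m K] has Gram matrix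
    [K^T *m (N *m N^T *m K) = 0], so it vanishes. *)
Lemma trmx_sub_gram (R : realFieldType) m n (N : 'M[R]_(m, n)) :
  (N^T <= N *m N^T)%MS.
Proof.
rewrite submxE; set K := cokermx _; apply/eqP/mulmx_tr_eq0.
by rewrite trmx_mul trmxK -mulmxA (mulmxA N) mulmx_coker mulmx0.
Qed.

(* For symmetric [A], the row spaces of [A] and [A *m A] agree, so
   [A = B *m A *m A = A *m A *m C] and [B *m A *m C] is the group inverse. *)
Lemma group_inverseP (R : realType) n (A : 'M[R]_n) :
  A^T = A -> is_group_inverse A (group_inverse A).
Proof.
move=> symA.
have /submxP[B AB] : (A <= A *m A)%MS.
  by have := trmx_sub_gram A; rewrite symA.
pose C := B^T.
have AC : A = A *m A *m C.
  by rewrite -[LHS]symA {1}AB !trmx_mul symA.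
have BAAC : B *m A = A *m C by rewrite [in LHS]AC !mulmxA -(mulmxA B) -AB.
have AXE : A *m (B *m A *m C) = A *m C.
  by rewrite BAAC !mulmxA -AC.
have XAE : B *m A *m C *m A = A *m C.
  by rewrite -!mulmxA (mulmxA A) -BAAC -!mulmxA -AB.
have X1 : is_group_inverse A (B *m A *m C).
  split; first by rewrite AXE -BAAC -mulmxA -AB.
  - by rewrite XAE -BAAC -(mulmxA B A (_ *m _)) AXE mulmxA.
  - by rewrite AXE XAE.
by apply: xgetPex; exists (B *m A *m C).
Qed.

(** Eliminates the group inverse through [A *m X *m A = A], once the vector is known to lie in the
    range of [A]. *)
Lemma group_inverse_quad (R : realType) n (A : 'M[R]_n) (z : 'cV[R]_n) :
  A^T = A -> (A *m z)^T *m group_inverse A *m (A *m z) = z^T *m A *m z.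
Proof.
move=> symA; have [AXA _ _] := group_inverseP symA.
by rewrite trmx_mul symA -!mulmxA (mulmxA A _ (A *m z)) (mulmxA _ A z) AXA.
Qed.

Lemma set_maxE (R : realType) (S : set R) (m : R) :
  S m -> ubound S m -> set_max S = m.
Proof.
move=> Sm ubm; apply: xget_unique; first by split.
by move=> y [Sy uby]; apply/eqP; rewrite eq_le ubm//= uby.
Qed.

Lemma set_minE (R : realType) (S : set R) (m : R) :
  S m -> lbound S m -> set_min S = m.
Proof.
move=> Sm lbm; apply: xget_unique; first by split.
by move=> y [Sy lby]; apply/eqP; rewrite eq_le lby//= lbm.
Qed.

(** * The bound and its equality case *)

Lemma independent_cliqueI (T : finType) (e : rel T) (C Q : {set T}) :
  independent e C -> clique e Q -> (#|C :&: Q| <= 1)%N.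
Proof.
move=> /forall_inP indC /andP[_ /forall_inP clQ]; apply/card_le1P => u.
rewrite inE => /andP[uC uQ] v; rewrite !inE; apply/andP/eqP => [[vC vQ]|->//].
apply/eqP; apply: contraTT vC => nvu; apply/negP => vC.
have /forall_inP/(_ v vC)/negP := indC u uC; apply.
by have /forall_inP/(_ v vQ)/implyP := clQ u uQ; apply; rewrite eq_sym.
Qed.

Lemma sum_enum_val (R : nmodType) (T : finType) (F : T -> R) :
  \sum_(i < #|T|) F (enum_val i) = \sum_u F u.
Proof. by rewrite -big_enum_val. Qed.

Section Covering.
Variables (R : realType) (T : finType) (e : rel T) (E : {set {set T}}).
Hypotheses (T_nonempty : (0 < #|T|)%N) (e_noiso : no_isolated_vertices e).
Hypothesis E_cov : clique_covering e E.

Local Notation d := (cov_degree E).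
Local Notation delta := (min_cov_degree E).
Local Notation A := (clique_covering_matrix E R e).
Local Notation x := (cov_degree_vector E R).

Lemma cov_degreeE u : (d u)%:R = \sum_(Q in E | u \in Q) 1 :> R.
Proof. by rewrite /cov_degree -sum1dep_card natr_sum. Qed.

Lemma cov_degree_gt0 u : (0 < d u)%N.
Proof.
have [v euv] := e_noiso u; have [Q QE /andP[uQ _]] := E_cov.2 _ _ euv.
by apply/card_gt0P; exists Q; rewrite inE QE.
Qed.

Lemma min_cov_degree_le u : (delta <= d u)%N.
Proof. exact: (@bigmin_le _ nat T #|E| u d). Qed.

Lemma min_cov_degree_attained : exists u, d u = delta.
Proof.
have /card_gt0P[u0 _] := T_nonempty.
(* The default [#|E|] of the big minimum also dominates the least degree; this is the base case of
   the closing induction. *)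
have dE u : (d u <= #|E|)%N.
  by apply: subset_leq_card; apply/fintype.subsetP => Q; rewrite inE => /andP[].
pose u := [arg min_(u < u0) d u].
have du v : (d u <= d v)%N by rewrite /u; case: arg_minnP => // w _; apply.
exists u; apply/eqP; rewrite eqn_leq min_cov_degree_le andbT.
by rewrite /min_cov_degree; elim/big_ind: _ => // a b ha hb; rewrite leq_min ha.
Qed.

Lemma min_cov_degree_gt0 : (0 < delta)%N.
Proof. by have [u <-] := min_cov_degree_attained; apply: cov_degree_gt0. Qed.

Definition incidence : 'M[R]_(#|T|, #|E|) :=
  \matrix_(i, j) (enum_val i \in (enum_val j : {set T}))%:R.

Lemma clique_covering_matrixE : A = incidence *m incidence^T.
Proof.
apply/matrixP => i j; rewrite !mxE.
under eq_bigr do rewrite !mxE -natrM mulnb.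
rewrite -(big_enum_val (fun Q : {set T} =>
  ((enum_val i \in Q) && (enum_val j \in Q))%:R)) /=.
rewrite -natr_sum -big_mkcondr sum1dep_card; case: eqVneq => [->|nij].
  by congr _%:R; apply: eq_card => Q; rewrite !inE andbb.
(* Distinct nonadjacent vertices share no clique, so the Gram entry is 0 here too. *)
case: ifP => // /negP nij_e; apply/esym; rewrite (_ : #|_| = 0%N)//.
apply: eq_card0 => Q; rewrite !inE; apply/negP => /and3P[QE iQ jQ].
apply: nij_e; have /andP[_ /forall_inP/(_ _ iQ)/forall_inP/(_ _ jQ)] := E_cov.1 _ QE.
by move/implyP; apply.
Qed.

Lemma clique_covering_matrix_sym : A^T = A.
Proof. by rewrite clique_covering_matrixE trmx_mul trmxK. Qed.

(* [p = N^T z] for the incidence matrix [N], where [A z = x]. *)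
Lemma cov_degree_quad : exists p : {set T} -> R,
  [/\ exists z : T -> R, forall Q, p Q = \sum_(u in Q) z u,
      forall u, \sum_(Q in E | u \in Q) p Q = (d u)%:R
    & (x^T *m group_inverse A *m x) ord0 ord0 = \sum_(Q in E) p Q ^+ 2].
Proof.
have xN : x = incidence *m const_mx 1.
  apply/colP => i; rewrite !mxE cov_degreeE.
  under [RHS]eq_bigr do rewrite !mxE mulr1.
  rewrite -(big_enum_val (fun Q : {set T} => (enum_val i \in Q)%:R)).
  by rewrite big_mkcondr; apply: eq_bigr => Q _; case: (_ \in Q).
(* [x] lies in the column space of [N], which is contained in that of [A = N N^T]. *)
have /submxP[w xw] : (x^T <= A)%MS.
  rewrite xN trmx_mul clique_covering_matrixE.
  exact: submx_trans (submxMl _ _) (trmx_sub_gram _).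
have {xw} xAw : x = A *m w^T.
  by apply: trmx_inj; rewrite xw trmx_mul trmxK clique_covering_matrix_sym.
pose z u := w ord0 (enum_rank u).
have pE (j : 'I_#|E|) :
    (incidence^T *m w^T) j ord0 = \sum_(u in (enum_val j : {set T})) z u.
  rewrite mxE [RHS]big_mkcond -[RHS]sum_enum_val; apply: eq_bigr => i _.
  rewrite !mxE /z enum_valK; case: (_ \in _); by rewrite ?mul1r ?mul0r.
exists (fun Q : {set T} => \sum_(u in Q) z u); split=> [|u|]; first by exists z.
  have := congr1 (fun m : 'cV_#|T| => m (enum_rank u) ord0) xAw.
  rewrite mxE enum_rankK => ->.
  rewrite clique_covering_matrixE -mulmxA mxE big_mkcondr big_enum_val.
  apply: eq_bigr => j _; rewrite pE mxE enum_rankK.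
  by case: (_ \in _); rewrite ?mul1r ?mul0r.
rewrite xAw (group_inverse_quad _ clique_covering_matrix_sym).
rewrite clique_covering_matrixE mulmxA -mulmxA -[_^T *m incidence]trmxK.
rewrite trmx_mul trmxK mxE [RHS]big_enum_val.
by apply: eq_bigr => j _; rewrite mxE pE expr2.
Qed.

(** Since [A u u = x u = d u], each ratio is [1 / d u], and a vertex of least degree maximizes
    it. *)
Lemma F_boundE : F_bound A x =
  (x^T *m group_inverse A *m x) ord0 ord0 / delta%:R.
Proof.
congr (_ * _).
have AuuE i : A i i / x i ord0 ^+ 2 = (d (enum_val i))%:R^-1.
  rewrite !mxE /= eqxx expr2 invfM mulrA divff ?mul1r//.
  by rewrite pnatr_eq0 -lt0n cov_degree_gt0.
have [u du] := min_cov_degree_attained.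
apply: set_maxE; first by exists (enum_rank u) => //; rewrite AuuE enum_rankK du.
move=> _ [i _ <-]; rewrite AuuE lef_pV2 ?posrE ?ltr0n ?cov_degree_gt0//.
  by rewrite ler_nat min_cov_degree_le.
exact: min_cov_degree_gt0.
Qed.

(* With [q Q] the sum of [1 / d u] over [C :&: Q], this is
   [sum (p - delta q)^2 = sum p^2 - 2 delta |C| + delta^2 sum_C 1 / d u]. *)
Lemma F_bound_identity (p : {set T} -> R) (C : {set T}) :
    (forall u, \sum_(Q in E | u \in Q) p Q = (d u)%:R) ->
    independent e C ->
  \sum_(Q in E) p Q ^+ 2 - delta%:R * #|C|%:R =
  \sum_(Q in E) (p Q - delta%:R * \sum_(u in C :&: Q) (d u)%:R^-1) ^+ 2 +
  delta%:R * \sum_(u in C) (1 - delta%:R / (d u)%:R).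
Proof.
move=> pd indC; pose q (Q : {set T}) : R := \sum_(u in C :&: Q) (d u)%:R^-1.
have exch (g : {set T} -> T -> R) :
    \sum_(Q in E) \sum_(u in C :&: Q) g Q u =
    \sum_(u in C) \sum_(Q in E | u \in Q) g Q u.
  rewrite (exchange_big_dep (mem C)) /=; last first.
    by move=> Q u _; rewrite inE => /andP[].
  apply: eq_bigr => u uC; apply: eq_bigl => Q.
  by rewrite inE uC.
have d0 u : (d u)%:R != 0 :> R by rewrite pnatr_eq0 -lt0n cov_degree_gt0.
have pq : \sum_(Q in E) p Q * q Q = #|C|%:R.
  under eq_bigr do rewrite mulr_sumr.
  rewrite exch -sum1_card natr_sum; apply: eq_bigr => u uC.
  by rewrite -mulr_suml pd divff.
have qq : \sum_(Q in E) q Q ^+ 2 = \sum_(u in C) (d u)%:R^-1.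
  (* A clique meets [C] at most once, so [q Q] has at most one term and can be squared termwise. *)
  transitivity (\sum_(Q in E) \sum_(u in C :&: Q) ((d u)%:R^-1 : R) ^+ 2).
    apply: eq_bigr => Q QE; rewrite /q.
    have := independent_cliqueI indC (E_cov.1 _ QE).
    rewrite leq_eqVlt => /orP[/cards1P[u ->]|]; first by rewrite !big_set1.
    by rewrite ltnS leqn0 cards_eq0 => /eqP->; rewrite !big_set0 expr0n.
  rewrite exch; apply: eq_bigr => u uC.
  rewrite -[X in \sum_(_ in _ | _) X]mul1r -mulr_suml -cov_degreeE.
  by rewrite expr2 mulrA divff ?mul1r.
have -> : \sum_(Q in E) (p Q - delta%:R * q Q) ^+ 2 =
    \sum_(Q in E) p Q ^+ 2 - 2 * delta%:R * #|C|%:R +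
    delta%:R ^+ 2 * \sum_(u in C) (d u)%:R^-1.
  rewrite -pq -qq !mulr_sumr -sumrB -big_split; apply: eq_bigr => Q _ /=.
  by ring.
rewrite big_split /= sumrN -mulr_sumr sumr_const.
by ring.
Qed.

Lemma natr_min_cov_degree_gt0 : 0 < delta%:R :> R.
Proof. by rewrite ltr0n min_cov_degree_gt0. Qed.

Lemma cov_slack_ge0 u : 0 <= 1 - delta%:R / (d u)%:R :> R.
Proof.
by rewrite subr_ge0 ler_pdivrMr ?ltr0n ?cov_degree_gt0// mul1r ler_nat
           min_cov_degree_le.
Qed.

Lemma cov_slack_sum_ge0 (C : {set T}) :
  0 <= delta%:R * \sum_(u in C) (1 - delta%:R / (d u)%:R) :> R.
Proof.
rewrite mulr_ge0 ?(ltW natr_min_cov_degree_gt0)// sumr_ge0// => u _.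
exact: cov_slack_ge0.
Qed.

Lemma independent_le_F_bound (C : {set T}) :
  independent e C -> #|C|%:R <= F_bound A x.
Proof.
move=> indC; rewrite F_boundE ler_pdivlMr ?natr_min_cov_degree_gt0//.
have [p [_ pd ->]] := cov_degree_quad.
rewrite mulrC -subr_ge0 (F_bound_identity pd indC) addr_ge0//.
  by apply: sumr_ge0 => Q _; apply: sqr_ge0.
exact: cov_slack_sum_ge0.
Qed.

Lemma F_bound_eq_tight (C : {set T}) :
  independent e C -> #|C|%:R = F_bound A x -> tight_independent_set E e C.
Proof.
move=> indC; rewrite F_boundE; have [p [_ pd ->]] := cov_degree_quad => CF.
have {CF} : \sum_(Q in E) p Q ^+ 2 - delta%:R * #|C|%:R = 0.
  by rewrite CF mulrCA divff ?mulr1 ?subrr// gt_eqF ?natr_min_cov_degree_gt0.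
rewrite (F_bound_identity pd indC) => /eqP.
rewrite paddr_eq0; first last.
- exact: cov_slack_sum_ge0.
- by apply: sumr_ge0 => Q _; apply: sqr_ge0.
move=> /andP[/eqP sq0 /eqP sl0].
have dC v : v \in C -> d v = delta.
  move=> vC; have /eqP := sl0; rewrite mulf_eq0 gt_eqF ?natr_min_cov_degree_gt0//=.
  move=> /eqP/(psumr_eq0P (fun u _ => cov_slack_ge0 u))/(_ v vC)/eqP.
  rewrite subr_eq0 eq_sym -(inj_eq (mulIf (_ : (d v)%:R != 0))); last first.
    by rewrite pnatr_eq0 -lt0n cov_degree_gt0.
  by rewrite divfK ?pnatr_eq0 -?lt0n ?cov_degree_gt0// mul1r eqr_nat => /eqP.
(* The squares vanish, so [p = delta q], and every term of [delta q] is 1 because [d u = delta] on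
   [C]. *)
have pC Q : Q \in E -> p Q = #|C :&: Q|%:R.
  move=> QE; have /eqP := psumr_eq0P (fun Q _ => sqr_ge0 _) sq0 QE.
  rewrite sqrf_eq0 subr_eq0 => /eqP ->.
  under eq_bigr => u do rewrite inE => /andP[uC _].
  rewrite (eq_bigr (fun=> delta%:R^-1)); last first.
    by move=> u; rewrite inE => /andP[/dC-> _].
  by rewrite sumr_const mulrnAr divff ?gt_eqF ?natr_min_cov_degree_gt0.
split=> // Q QE.
(* Cliques are nonempty, so pick [u] in [Q]. The [d u] values of [p] on the cliques through [u] are
   at most 1 and sum to [d u], so all equal 1. *)
have /andP[/set0Pn[u uQ] _] := E_cov.1 _ QE.
have le1 Q' : Q' \in E -> (#|C :&: Q'|%:R : R) <= 1.
  by move=> /(E_cov.1 _) clQ; rewrite (ler_nat _ _ 1) (independent_cliqueI indC clQ).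
have := pd u; rewrite cov_degreeE => /esym/eqP; rewrite -subr_eq0 -sumrB => /eqP s0.
have /eqP : 1 - p Q = 0.
  apply: (psumr_eq0P _ s0); last by rewrite QE.
  by move=> Q' /andP[Q'E _]; rewrite subr_ge0 pC// le1.
by rewrite subr_eq0 eq_sym pC// pnatr_eq1 => /eqP.
Qed.

(** Tightness kills the slack and makes [delta q = 1] on every clique, leaving [|p - 1|^2]. Here
    [p - 1 = N^T y] where [y] is [z] minus the indicator of [C], while [N (p - 1) = x - x = 0];
    hence [|p - 1|^2 = y^T N (p - 1) = 0]. *)
Lemma tight_F_bound (C : {set T}) :
  tight_independent_set E e C -> F_bound A x = #|C|%:R.
Proof.
case=> indC dC CQ; rewrite F_boundE; have [p [[z pz] pd ->]] := cov_degree_quad.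
apply: (canLR (mulfK _)); first by rewrite gt_eqF ?natr_min_cov_degree_gt0.
apply/eqP; rewrite [_ * delta%:R]mulrC -subr_eq0 (F_bound_identity pd indC).
rewrite [X in _ + _ * X]big1 ?mulr0 ?addr0; last first.
  by move=> u /dC->; rewrite divff ?subrr// gt_eqF ?natr_min_cov_degree_gt0.
pose y u : R := z u - (u \in C)%:R.
have p1 Q : Q \in E -> delta%:R * \sum_(u in C :&: Q) (d u)%:R^-1 = 1 :> R.
  move=> QE; rewrite mulr_sumr (eq_bigr (fun=> 1)) => [|u]; last first.
    rewrite inE => /andP[/dC-> _].
    by rewrite divff// gt_eqF ?natr_min_cov_degree_gt0.
  by rewrite sumr_const CQ.
have py Q : Q \in E -> p Q - 1 = \sum_(u in Q) y u.
  move=> QE; rewrite pz sumrB; congr (_ - _).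
  transitivity (#|C :&: Q|%:R : R); first by rewrite CQ.
  rewrite -sum1_card natr_sum big_mkcond [RHS]big_mkcond.
  by apply: eq_bigr => u _; rewrite inE; case: (u \in C); case: (u \in Q).
rewrite (eq_bigr (fun Q : {set T} => \sum_(u in Q) y u * (p Q - 1)));
  last by move=> Q QE; rewrite p1// -mulr_suml -py.
rewrite (exchange_big_dep predT)//= big1// => u _.
by rewrite -mulr_sumr sumrB pd cov_degreeE subrr mulr0.
Qed.

End Covering.

Lemma independence_number_attained (T : finType) (e : rel T) :
  exists2 C : {set T}, independent e C & independence_number e = #|C|.
Proof.
have ne : (0 < #|[pred S : {set T} | independent e S]|)%N.
  by apply/card_gt0P; exists finset.set0; apply/forall_inP => u; rewrite inE.
by have [C indC maxC] := eq_bigmax_cond (fun S : {set T} => #|S|) ne; exists C.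
Qed.

Lemma independent_le_independence_number (T : finType) (e : rel T)
  (C : {set T}) : independent e C -> (#|C| <= independence_number e)%N.
Proof. by move=> indC; apply: leq_bigmax_cond. Qed.

(** * Shannon capacity *)

Lemma strong_power_independent_le (T : finType) (e : rel T) (E : {set {set T}})
    (k : nat) (S : {set k.-tuple T}) :
    clique_covering e E -> independent (strong_power e (k := k)) S ->
  (#|S| * min_cov_degree E ^ k <= #|E| ^ k)%N.
Proof.
move=> E_cov /forall_inP indS.
pose meets (f : {ffun 'I_k -> {set T}}) (s : k.-tuple T) :=
  [forall i, tnth s i \in f i].
apply: (@leq_trans (\sum_(s in S) \prod_(i < k) cov_degree E (tnth s i))).
  rewrite -sum_nat_const leq_sum// => s _.
  rewrite -[k in X in (X <= _)%N]card_ord -prod_nat_const leq_prod// => i _.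
  exact: min_cov_degree_le.
(* Distributing the product of clique counts over the coordinates yields a count of the families [f]
   of [k] cliques whose product contains [s]. *)
have degE (s : k.-tuple T) : (\prod_(i < k) cov_degree E (tnth s i) =
    \sum_(f in ffun_on (mem E)) meets f s)%N.
  rewrite (eq_bigr (fun i => \sum_(Q in E) (tnth s i \in Q : nat))%N); last first.
    move=> i _; rewrite /cov_degree -sum1dep_card big_mkcondr.
    by apply: eq_bigr => Q _; case: ifP.
  rewrite bigA_distr_big; apply: eq_bigr => f _; rewrite /meets.
  have [/forallP sf|/forallPn[i sf]] := boolP [forall i, tnth s i \in f i].
    by rewrite big1// => i _; rewrite sf.
  by rewrite (bigD1 i)//= (negPf sf).
rewrite (eq_bigr _ (fun s _ => degE s)) exchange_big /=.
have <- : #|ffun_on (mem E) : {pred {ffun 'I_k -> {set T}}}| = (#|E| ^ k)%N.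
  by rewrite card_ffun_on card_ord.
rewrite -sum1_card; apply: leq_sum => f /ffun_onP fE.
(* Two tuples in one product of cliques are equal or adjacent in the strong power, so each family
   [f] accounts for at most one element of [S]. *)
rewrite -big_mkcondr sum1dep_card; apply/card_le1P => s.
rewrite inE => /andP[sS /forallP sf] t; rewrite !inE.
apply/andP/eqP => [[tS /forallP tf]|->]; last by split=> //; apply/forallP.
apply/eqP; rewrite eq_sym; apply: contraT => nst.
have /forall_inP/(_ t tS)/negP[] := indS s sS.
rewrite /strong_power nst; apply/forallP => i.
have /andP[_ /forall_inP/(_ _ (sf i))/forall_inP/(_ _ (tf i))] := E_cov.1 _ (fE i).
by case: eqP.
Qed.

(** The tuples with all entries in [C] are independent: within [C], equal or adjacent means equal in
    each coordinate. *)
Lemma strong_power_independent_ge (T : finType) (e : rel T) (C : {set T})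
    (k : nat) : independent e C ->
  (#|C| ^ k <= independence_number (strong_power e (k := k)))%N.
Proof.
move=> /forall_inP indC.
pose tup (f : {ffun 'I_k -> T}) := [tuple f i | i < k].
have tup_inj : injective tup.
  move=> f g fg; apply/ffunP => i.
  by have := congr1 (fun t => tnth t i) fg; rewrite !tnth_mktuple.
have <- : #|[set tup f | f in ffun_on (mem C)]| = (#|C| ^ k)%N.
  by rewrite card_imset// card_ffun_on card_ord.
apply: independent_le_independence_number.
apply/forall_inP => _ /imsetP[f /ffun_onP fC ->].
apply/forall_inP => _ /imsetP[g /ffun_onP gC ->].
apply/negP => /andP[/eqP nfg /forallP fg].
apply: nfg; congr tup; apply/ffunP => i; have := fg i; rewrite !tnth_mktuple.
have /forall_inP/(_ _ (gC i))/negPf-> := indC _ (fC i).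
by rewrite orbF => /eqP.
Qed.

(** Double count the pairs of a vertex of [C] and a clique containing it. *)
Lemma tight_card (T : finType) (e : rel T) (E : {set {set T}}) (C : {set T}) :
  tight_independent_set E e C -> (#|C| * min_cov_degree E = #|E|)%N.
Proof.
case=> _ dC CQ; rewrite -sum_nat_const.
under eq_bigr => u uC do rewrite -(dC u uC) /cov_degree -sum1dep_card.
rewrite (exchange_big_dep (mem E)) /=; last by move=> u Q _ /andP[].
rewrite -sum1_card; apply: eq_bigr => Q QE; rewrite -[RHS](CQ Q QE) -[RHS]sum1_card.
by apply: eq_bigl => u; rewrite !inE QE.
Qed.

Lemma tight_shannon_capacity (R : realType) (T : finType) (e : rel T)
    (E : {set {set T}}) (C : {set T}) :
    (0 < min_cov_degree E)%N -> clique_covering e E ->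
    tight_independent_set E e C ->
  shannon_capacity R e = #|C|%:R.
Proof.
move=> d0 E_cov tC; have [indC _ _] := tC.
(* The sequence is constantly [#|C|] for [k > 0]; at [k = 0] the exponent [0^-1] is 0, so that term
   is set aside. *)
apply: lim_near_cst => //; near=> k.
have k0 : (0 < k)%N by near: k; exact: nbhs_infty_gt.
have -> : independence_number (strong_power e (k := k)) = (#|C| ^ k)%N.
  apply/eqP; rewrite eqn_leq strong_power_independent_ge// andbT.
  have [S indS ->] := independence_number_attained (strong_power e (k := k)).
  have := strong_power_independent_le E_cov indS.
  by rewrite -(tight_card tC) expnMn leq_pmul2r// expn_gt0 d0.
rewrite natrX -powR_mulrn// -powRrM divff ?powRr1//.
by rewrite pnatr_eq0 -lt0n.
Unshelve. all: by end_near. Qed.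

(** * Largest eigenvalues and the theta function *)

Lemma quad_formE (R : comNzRingType) n (M : 'M[R]_n) (v : 'rV[R]_n) :
  (v *m M *m v^T) ord0 ord0 = \sum_j \sum_i v ord0 i * M i j * v ord0 j.
Proof.
by rewrite mxE; apply: eq_bigr => j _; rewrite !mxE mulr_suml.
Qed.

(** Serves twice below: for the function maximized on the unit sphere and, with the identity matrix,
    for the closedness of that sphere. *)
Lemma quad_form_continuous (R : realType) n (M : 'M[R]_n) :
  continuous (fun v : 'rV[R]_n => (v *m M *m v^T) ord0 ord0).
Proof.
rewrite (_ : (fun v : 'rV[R]_n => _) =
    fun v : 'rV[R]_n => \sum_j \sum_i v ord0 i * M i j * v ord0 j); last first.
  by apply/funext => v; rewrite quad_formE.
have cD (x : R * R) : {for x, continuous (fun y : R * R => y.1 + y.2)}.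
  exact: add_continuous.
have csum (F : 'I_n -> 'rV[R]_n -> R) :
    (forall i, continuous (F i)) -> continuous (fun v => \sum_i F i v).
  move=> cF v; exact: (@cvg_big R 'I_n +%R 0 predT cD
    _ (nbhs v) (index_enum 'I_n) F (F ^~ v) (nbhs_filter v)
    (fun i _ => cF i v)).
apply: (csum) => j; apply: csum => i v.
have cc k : continuous (fun u : 'rV[R]_n => u ord0 k) by exact: coord_continuous.
have c1 : {for v, continuous (fun _ : 'rV[R]_n => M i j)} by exact: cst_continuous.
exact: (continuousM (continuousM (cc i v) c1) (cc j v)).
Qed.

(** Perturb [c] along [w = c *m B]: the form at [c + t *: w] is [2 t s + t^2 q] with [s = |w|^2],
    and its nonnegativity for all [t] forces [s = 0]. *)
Lemma psd_form_eq0 (R : realFieldType) n (B : 'M[R]_n) (c : 'rV[R]_n) :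
    B^T = B -> (forall v : 'rV_n, 0 <= (v *m B *m v^T) ord0 ord0) ->
  (c *m B *m c^T) ord0 ord0 = 0 -> c *m B = 0.
Proof.
move=> symB psdB cBc; set w := c *m B.
suff: (w *m w^T) ord0 ord0 = 0.
  move=> ww; apply: trmx_inj; rewrite trmx0; apply: mulmx_tr_eq0.
  by rewrite trmxK; apply/matrixP => i j; rewrite !ord1 ww mxE.
pose s := (w *m w^T) ord0 ord0; pose q := (w *m B *m w^T) ord0 ord0.
have q0 : 0 <= q by apply: psdB.
have quad t : 0 <= 2 * t * s + t ^+ 2 * q.
  have := psdB (c + t *: w); congr (_ <= _).
  rewrite mulmxDl linearD /= linearZ /= mulmxDl !mulmxDr -!scalemxAl -!scalemxAr.
  have -> : w *m B *m c^T = w *m w^T by rewrite -mulmxA trmx_mul symB.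
  have entD (X Y : 'M[R]_1) : (X + Y) ord0 ord0 = X ord0 ord0 + Y ord0 ord0.
    by rewrite mxE.
  have entZ b (X : 'M[R]_1) : (b *: X) ord0 ord0 = b * X ord0 ord0 by rewrite mxE.
  rewrite !entD !entZ cBc -/w -/s -/q.
  by ring.
have sq : 0 <= - (s ^+ 2 * (q + 2)).
  (* A negative [t] small enough for the linear term to dominate; [q + 1] keeps the denominator
     positive when [q = 0]. *)
  pose t := - s / (q + 1).
  rewrite (_ : - _ = (q + 1) ^+ 2 * (2 * t * s + t ^+ 2 * q)).
    by rewrite mulr_ge0 ?sqr_ge0.
  by rewrite /t; field; rewrite gt_eqF ?ltr_wpDl.
apply/eqP; rewrite -[_ == 0]orbF -/s -sqrf_eq0 eq_le sqr_ge0 andbT.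
rewrite oppr_ge0 pmulr_lle0 in sq; last by rewrite ltr_wpDl.
by rewrite sq.
Qed.

Lemma quad_form_scale (R : comNzRingType) n (M : 'M[R]_n) a (v : 'rV[R]_n) :
  (a *: v *m M *m (a *: v)^T) ord0 ord0 = a ^+ 2 * (v *m M *m v^T) ord0 ord0.
Proof.
by rewrite linearZ /= -!scalemxAl -scalemxAr scalerA mxE expr2.
Qed.

Lemma sqnormE (R : comNzRingType) n (v : 'rV[R]_n) :
  (v *m v^T) ord0 ord0 = \sum_i v ord0 i ^+ 2.
Proof. by rewrite mxE; apply: eq_bigr => i _; rewrite mxE expr2. Qed.

Lemma sqnorm_eq0 (R : realFieldType) n (v : 'rV[R]_n) :
  ((v *m v^T) ord0 ord0 == 0) = (v == 0).
Proof.
rewrite sqnormE; apply/eqP/eqP => [s0|->]; last first.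
  by rewrite big1// => i _; rewrite mxE expr0n.
apply/rowP => i; rewrite mxE; apply/eqP; rewrite -sqrf_eq0; apply/eqP.
exact: (psumr_eq0P (fun i _ => sqr_ge0 (v ord0 i)) s0).
Qed.

(** Let [c] maximize the form [f] on the unit sphere. Then [f c - M] is positive semidefinite with
    form zero at [c], so it annihilates [c]. *)
Lemma symmetric_top_eigenvalue (R : realType) n (M : 'M[R]_n) :
  (0 < n)%N -> M^T = M ->
  exists2 l, eigenvalue M l &
    forall v : 'rV_n, (v *m M *m v^T) ord0 ord0 <= l * (v *m v^T) ord0 ord0.
Proof.
move=> n0 symM; pose f (v : 'rV[R]_n) := (v *m M *m v^T) ord0 ord0.
pose S := [set v : 'rV[R]_n | (v *m 1%:M *m v^T) ord0 ord0 = 1]%classic.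
have SE v : S v = ((v *m v^T) ord0 ord0 = 1) by rewrite /S /= mulmx1.
have S0 : (S !=set0)%classic.
  exists (delta_mx ord0 (Ordinal n0)); rewrite SE sqnormE.
  rewrite (bigD1 (Ordinal n0))//= big1 => [|i /negPf ni].
    by rewrite mxE !eqxx expr1n addr0.
  by rewrite mxE ni andbF expr0n.
(* The sphere is a closed subset of the cube of vectors with entries in [[-1, 1]]. *)
have cS : compact S.
  apply: (@subclosed_compact _ _
    [set v : 'rV[R]_n | forall i, `[-1, 1]%classic (v ord0 i)]%classic).
  - have cl1 : closed [set x : R | x = 1]%classic by apply: closed_eq.
    by apply: (preimage_closed _ cl1) => v _; apply: quad_form_continuous.
  - exact: (rV_compact (fun=> @segment_compact R (-1) 1)).
  - move=> v; rewrite SE sqnormE => Sv i /=; rewrite in_itv /= -ler_norml.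
    rewrite -(@ler_pXn2r _ 2) ?nnegrE// expr1n real_normK ?num_real// -Sv.
    by rewrite (bigD1 i)//= lerDl sumr_ge0// => j _; apply: sqr_ge0.
have [c /set_mem + maxc] := EVT_max_rV S0 cS
  (continuous_subspaceT (@quad_form_continuous R n M)).
rewrite SE => Sc.
have top v : f v <= f c * (v *m v^T) ord0 ord0.
  have [->|v0] := eqVneq v 0; first by rewrite /f !mul0mx !mxE mulr0.
  set s := (v *m v^T) ord0 ord0.
  have s0 : 0 < s.
    rewrite lt_neqAle eq_sym sqnorm_eq0 v0 /s sqnormE.
    by apply: sumr_ge0 => i _; apply: sqr_ge0.
  pose a := (Num.sqrt s)^-1.
  have a2 : a ^+ 2 = s^-1 by rewrite exprVn sqr_sqrtr ?ltW.
  have Sav : a *: v \in S.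
    by apply/mem_set; rewrite /S /= quad_form_scale mulmx1 a2 mulVf ?gt_eqF.
  have := maxc _ Sav; rewrite quad_form_scale a2 -/(f v) -/(f c).
  by rewrite mulrC ler_pdivrMr.
exists (f c) => //; apply/eigenvalueP; exists c; last first.
  by rewrite -sqnorm_eq0 Sc oner_eq0.
apply/eqP; rewrite -mul_mx_scalar eq_sym -subr_eq0 -mulmxBr; apply/eqP.
have entB a (X Y : 'M[R]_1) :
    (a *: X - Y) ord0 ord0 = a * X ord0 ord0 - Y ord0 ord0 by rewrite !mxE.
have formB v : (v *m ((f c)%:M - M) *m v^T) ord0 ord0 =
    f c * (v *m v^T) ord0 ord0 - f v.
  by rewrite mulmxBr mulmxBl mul_mx_scalar -scalemxAl entB.
apply: psd_form_eq0.
- by rewrite linearB /= tr_scalar_mx symM.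
- by move=> v; rewrite formB subr_ge0.
- by rewrite formB Sc mulr1 subrr.
Qed.

Lemma largest_eigenvalueP (R : realType) n (M : 'M[R]_n) :
  (0 < n)%N -> M^T = M ->
  eigenvalue M (largest_eigenvalue M) /\
  forall v : 'rV_n, (v *m M *m v^T) ord0 ord0 <=
    largest_eigenvalue M * (v *m v^T) ord0 ord0.
Proof.
move=> n0 symM; have [l lM topl] := symmetric_top_eigenvalue n0 symM.
suff -> : largest_eigenvalue M = l by [].
apply: set_maxE => // a /eigenvalueP[v vM v0].
have := topl v; rewrite vM -scalemxAl.
rewrite [X in X <= _ -> _]mxE ler_pM2r// lt_neqAle eq_sym sqnorm_eq0 v0 sqnormE.
by apply: sumr_ge0 => i _; apply: sqr_ge0.
Qed.

(** * Theta: the Rayleigh lower bound and a matrix attaining it *)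

Lemma independent_le_largest_eigenvalue (R : realType) (T : finType)
    (e : rel T) (C : {set T}) (M : 'M[R]_#|T|) :
    (0 < #|C|)%N -> independent e C -> theta_feasible e M ->
  #|C|%:R <= largest_eigenvalue M.
Proof.
move=> C0 /forall_inP indC [symM M1].
have T0 : (0 < #|T|)%N by apply: leq_trans C0 (max_card _).
pose c : 'rV[R]_#|T| := \row_i (enum_val i \in C)%:R.
have cC : \sum_i c ord0 i = #|C|%:R.
  under eq_bigr do rewrite mxE.
  rewrite (sum_enum_val (fun u => (u \in C)%:R)) -sum1_card natr_sum [RHS]big_mkcond.
  by apply: eq_bigr => u _; case: (_ \in _).
have cc : (c *m c^T) ord0 ord0 = #|C|%:R.
  rewrite sqnormE -cC; apply: eq_bigr => i _.
  by rewrite mxE -natrX; case: (_ \in _).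
(* Independence makes every entry of [M] on [C] times [C] equal to 1. *)
have cMc : (c *m M *m c^T) ord0 ord0 = #|C|%:R * #|C|%:R.
  rewrite quad_formE -cC mulr_sumr; apply: eq_bigr => j _; rewrite mulr_suml.
  apply: eq_bigr => i _; rewrite !mxE.
  have [iC|_] := boolP (enum_val i \in C); last by rewrite !mul0r.
  have [jC|_] := boolP (enum_val j \in C); last by rewrite !mulr0.
  by rewrite M1 ?mulr1//; have /forall_inP/(_ _ jC)-> := indC _ iC; rewrite orbT.
have [_ /(_ c)] := largest_eigenvalueP T0 symM.
by rewrite cMc cc ler_pM2r// ltr0n.
Qed.

(** Cauchy-Schwarz against the constant 1, from [sum (n f_i - s)^2 >= 0]. *)
Lemma sqr_sum_le (R : realFieldType) (I : finType) (A : {set I}) (f : I -> R) :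
  (\sum_(i in A) f i) ^+ 2 <= #|A|%:R * \sum_(i in A) f i ^+ 2.
Proof.
pose s := \sum_(i in A) f i; pose n : R := #|A|%:R.
have [A0|A0] := eqVneq #|A| 0%N.
  by move: A0 => /card0_eq A0; rewrite !big_pred0 ?mulr0 ?expr0n.
have n0 : 0 < n by rewrite ltr0n lt0n.
have : 0 <= \sum_(i in A) (n * f i - s) ^+ 2.
  by apply: sumr_ge0 => i _; apply: sqr_ge0.
have -> : \sum_(i in A) (n * f i - s) ^+ 2 =
    n * (n * \sum_(i in A) f i ^+ 2 - s ^+ 2).
  transitivity (n ^+ 2 * (\sum_(i in A) f i ^+ 2) - 2 * n * s * s + n * s ^+ 2).
    have -> : n * s ^+ 2 = \sum_(i in A) s ^+ 2 by rewrite sumr_const mulr_natl.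
    have -> : 2 * n * s * s = \sum_(i in A) 2 * n * s * f i by rewrite -mulr_sumr.
    rewrite mulr_sumr -sumrB -big_split.
    by apply: eq_bigr => i _ /=; ring.
  by ring.
by rewrite pmulr_rge0// subr_ge0.
Qed.

(** With [J] the all-ones matrix and [D] the diagonal of positive degrees, this is
    [J - |E| D^-1 N N^T D^-1 + |E| D^-1]; the last term restores the unit diagonal. *)
Definition cov_theta_matrix (R : realType) (T : finType)
    (E : {set {set T}}) : 'M[R]_#|T| :=
  \matrix_(i, j) let u := enum_val i in let v := enum_val j in
    if u == v then 1
    else 1 - #|E|%:R * (cov_weight E u v)%:R /
      ((cov_degree E u)%:R * (cov_degree E v)%:R).

Lemma cov_weightC (T : finType) (E : {set {set T}}) u v :
  cov_weight E u v = cov_weight E v u.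
Proof. by apply: eq_card => Q; rewrite !inE [(v \in Q) && _]andbC. Qed.

Lemma cov_theta_matrix_feasible (R : realType) (T : finType) (e : rel T)
  (E : {set {set T}}) : clique_covering e E ->
  theta_feasible e (cov_theta_matrix R E).
Proof.
move=> E_cov; split.
  apply/matrixP => i j; rewrite !mxE /= eq_sym; case: eqP => // _.
  rewrite cov_weightC; congr (1 - _ / _); exact: mulrC.
move=> i j; rewrite mxE /= (inj_eq enum_val_inj); case: eqVneq => //= nij nadj.
rewrite (_ : cov_weight _ _ _ = 0%N) ?mulr0 ?mul0r ?subr0//.
apply: eq_card0 => Q; rewrite !inE; apply/negP => /and3P[QE iQ jQ].
have /andP[_ /forall_inP/(_ _ iQ)/forall_inP/(_ _ jQ)] := E_cov.1 _ QE.
by rewrite (inj_eq enum_val_inj) nij (negPf nadj).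
Qed.

(* The form of [cov_theta_matrix] at [v] is
   [(sum v)^2 - |E| sum_Q g_Q^2 + |E| sum v_i^2 / d_i] with
   [g_Q = sum_(i in Q) v_i / d_i], and [sum_Q g_Q = sum v]. *)
Lemma cov_theta_matrix_form_le (R : realType) (T : finType) (e : rel T)
    (E : {set {set T}}) (m : R) (v : 'rV[R]_#|T|) :
    no_isolated_vertices e -> clique_covering e E ->
    #|E|%:R = m * (min_cov_degree E)%:R ->
  (v *m cov_theta_matrix R E *m v^T) ord0 ord0 <= m * (v *m v^T) ord0 ord0.
Proof.
move=> e_noiso E_cov Em.
pose d (i : 'I_#|T|) : R := (cov_degree E (enum_val i))%:R.
have d0 i : 0 < d i by rewrite ltr0n (cov_degree_gt0 e_noiso E_cov).
pose y i := v ord0 i / d i.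
pose inc (i : 'I_#|T|) (Q : {set T}) : R := (enum_val i \in Q)%:R.
pose g Q := \sum_i y i * inc i Q.
have incd i : \sum_(Q in E) inc i Q = d i.
  rewrite /d cov_degreeE big_mkcondr.
  by apply: eq_bigr => Q _; rewrite /inc; case: (_ \in Q).
have sumg : \sum_(Q in E) g Q = \sum_i v ord0 i.
  rewrite exchange_big; apply: eq_bigr => i _ /=.
  by rewrite -mulr_sumr incd divfK// gt_eqF.
have sumg2 : \sum_(Q in E) g Q ^+ 2 =
    \sum_j \sum_i y i * y j * (cov_weight E (enum_val i) (enum_val j))%:R.
  transitivity (\sum_(Q in E) \sum_j \sum_i y i * y j * (inc i Q * inc j Q)).
    apply: eq_bigr => Q _; rewrite expr2 mulr_sumr; apply: eq_bigr => j _.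
    by rewrite mulr_suml; apply: eq_bigr => i _; ring.
  rewrite exchange_big; apply: eq_bigr => j _ /=.
  rewrite exchange_big; apply: eq_bigr => i _ /=.
  rewrite -mulr_sumr; congr (_ * _); rewrite /cov_weight -sum1dep_card natr_sum.
  rewrite big_mkcondr; apply: eq_bigr => Q _; rewrite /inc -natrM mulnb.
  by case: (_ && _).
have weight_diag i : (cov_weight E (enum_val i) (enum_val i))%:R = d i.
  by congr _%:R; apply: eq_card => Q; rewrite !inE andbb.
have -> : (v *m cov_theta_matrix R E *m v^T) ord0 ord0 =
    (\sum_i v ord0 i) ^+ 2 - #|E|%:R * (\sum_(Q in E) g Q ^+ 2) +
    #|E|%:R * \sum_i v ord0 i ^+ 2 / d i.
  rewrite sumg2 quad_formE expr2 !mulr_sumr -sumrB -big_split.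
  apply: eq_bigr => j _ /=; rewrite mulr_suml mulr_sumr -sumrB.
  rewrite (bigD1 j)//= [in RHS](bigD1 j)//= weight_diag.
  rewrite mxE /= eqxx addrAC; congr (_ + _).
    by rewrite /y; field; rewrite gt_eqF ?d0.
  apply: eq_bigr => i ij; rewrite mxE /= (inj_eq enum_val_inj) (negPf ij).
  by rewrite /y -/(d i) -/(d j); field; rewrite !gt_eqF ?d0.
(* Cauchy-Schwarz over [E] makes the first two terms together nonpositive; the diagonal term is
   bounded by [|E| / d i = m delta / d i <= m]. *)
have CS := sqr_sum_le E g; rewrite sumg in CS.
have diagle : #|E|%:R * (\sum_i v ord0 i ^+ 2 / d i) <= m * (v *m v^T) ord0 ord0.
  rewrite sqnormE !mulr_sumr; apply: ler_sum => i _.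
  rewrite mulrCA [m * _]mulrC ler_wpM2l ?sqr_ge0// ler_pdivrMr// Em.
  rewrite ler_wpM2l ?ler_nat ?min_cov_degree_le//.
  (* The index [i] shows that [T] is nonempty, so [delta > 0], and [m delta = |E|] gives
     [m >= 0]. *)
  have T0 : (0 < #|T|)%N by apply: leq_trans (ltn_ord i).
  rewrite -(@pmulr_lge0 _ (min_cov_degree E)%:R) -?Em//.
  by rewrite ltr0n (min_cov_degree_gt0 T0 e_noiso E_cov).
by rewrite -[leRHS]add0r lerD// subr_le0.
Qed.

Lemma tight_lovasz_theta (R : realType) (T : finType) (e : rel T)
    (E : {set {set T}}) (C : {set T}) :
    (0 < #|T|)%N -> no_isolated_vertices e -> clique_covering e E ->
    tight_independent_set E e C ->
  lovasz_theta R e = #|C|%:R.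
Proof.
move=> T0 e_noiso E_cov tC; have [indC _ CQ] := tC.
(* Some clique exists and meets [C]. *)
have C0 : (0 < #|C|)%N.
  have d0 := min_cov_degree_gt0 T0 e_noiso E_cov.
  have /card_gt0P[u _] := T0.
  have /card_gt0P[Q] := cov_degree_gt0 e_noiso E_cov u.
  rewrite inE => /andP[/CQ <- _]; apply: subset_leq_card.
  exact: finset.subsetIl.
apply: set_minE; last first.
  by move=> _ [M feasM <-]; apply: independent_le_largest_eigenvalue feasM.
have feas := cov_theta_matrix_feasible R E_cov.
exists (cov_theta_matrix R E) => //; apply/eqP; rewrite eq_le.
rewrite (independent_le_largest_eigenvalue C0 indC feas) andbT.
(* Evaluating the form bound at an eigenvector for the largest eigenvalue bounds that eigenvalue by
   [#|C|]. *)
have [/eigenvalueP[v vM v0] _] := largest_eigenvalueP T0 feas.1.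
have Em : #|E|%:R = #|C|%:R * (min_cov_degree E)%:R :> R.
  by rewrite -natrM (tight_card tC).
have := cov_theta_matrix_form_le v e_noiso E_cov Em.
rewrite vM -scalemxAl [X in X <= _ -> _]mxE ler_pM2r//.
rewrite lt_neqAle eq_sym sqnorm_eq0 v0 sqnormE.
by apply: sumr_ge0 => i _; apply: sqr_ge0.
Qed.

Theorem theorem4p7 (R : realType) (T : finType) (e : rel T)
    (E : {set {set T}}) (T_nonempty : (0 < #|T|)%N)
    (e_sym : symmetric e) (e_irr : irreflexive e)
    (e_noiso : no_isolated_vertices e) (E_cov : clique_covering e E) :
  let A := clique_covering_matrix E R e in
  let x := cov_degree_vector E R in
  [/\ (independence_number e)%:R <= F_bound A x,
      (independence_number e)%:R = F_bound A x <->
        (exists C : {set T}, tight_independent_set E e C)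
    & forall C : {set T}, tight_independent_set E e C ->
        [/\ (independence_number e)%:R = shannon_capacity R e,
            shannon_capacity R e = lovasz_theta R e,
            lovasz_theta R e = #|C|%:R
          & #|C|%:R = F_bound A x]].
Proof.
move=> A x; have [C0 indC0 alphaE] := independence_number_attained e.
have alpha_le : (independence_number e)%:R <= F_bound A x.
  by rewrite alphaE; apply: independent_le_F_bound.
(* The squeeze [#|C| <= alpha <= F = #|C|]. *)
have tight_alpha C : tight_independent_set E e C ->
    F_bound A x = #|C|%:R /\ independence_number e = #|C|.
  move=> tC; have FC : F_bound A x = #|C|%:R by apply: tight_F_bound.
  split=> //; apply/eqP; rewrite eqn_leq -(ler_nat R) -FC alpha_le.
  by apply: independent_le_independence_number; case: tC.
split=> //.
- split=> [|[C /tight_alpha[-> ->]]//].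
  by rewrite alphaE => eqF; exists C0; apply: F_bound_eq_tight eqF.
- move=> C tC; have [-> ->] := tight_alpha C tC.
  rewrite (tight_lovasz_theta R T_nonempty e_noiso E_cov tC).
  have d0 := min_cov_degree_gt0 T_nonempty e_noiso E_cov.
  by rewrite (tight_shannon_capacity R d0 E_cov tC).
Qed.
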